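(* Let $d\geq 0$ be an integer and $c=(c_0,\ldots,c_d)\in\mathbb{R}^{d+1}$. Then there exists an integral partial polytopal complex $K$ with $\dim K\leq d$ such that $f^*(L_K,d)=c$ if and only if all $c_i$ are non-negative integers.
   Context: An integral partial polytopal complex is a finite disjoint union $K$ of relatively open polytopes (relative interiors of convex hulls of finitely many points) whose vertices lie in $\mathbb{Z}^n$; its dimension is the maximum dimension of these open polytopes. Its Ehrhart function $L_K(k)=\#(\mathbb{Z}^n\cap kK)$, $k\geq1$ an integer, agrees with a polynomial of degree at most $\dim K$, also denoted $L_K$. For a polynomial $p$ of degree at most $d$, its $f^*$-vector $f^*(p,d)=(f^*_0,\ldots,f^*_d)$ is the unique vector with $p(k)=\sum_{i=0}^d f^*_i\binom{k-1}{i}$, where $\binom{x}{i}=x(x-1)\cdots(x-i+1)/i!$. The $f^*$-vector of $K$ with respect to $d\geq\dim K$ is $f^*(L_K,d)$. *)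

(* Defs.v *)
From HB Require Import structures.
From mathcomp Require Import all_boot all_order all_algebra.
From mathcomp Require Import finmap.
From mathcomp Require Import all_classical all_reals.
From mathcomp Require Import topology normedtype.

Set Implicit Arguments.
Unset Strict Implicit.
Unset Printing Implicit Defensive.

Import Order.TTheory GRing.Theory Num.Theory.
Import numFieldNormedType.Exports.

Local Open Scope classical_set_scope.
Local Open Scope ring_scope.

Definition conv_hull (R : realType) (n : nat) (A : set 'rV[R]_n) :
    set 'rV[R]_n :=
  [set x | exists (m : nat) (a : 'I_m -> 'rV[R]_n) (w : 'I_m -> R),
    [/\ forall i, A (a i), forall i, 0 <= w i, \sum_(i < m) w i = 1
      & x = \sum_(i < m) w i *: a i]].

Definition aff_hull (R : realType) (n : nat) (A : set 'rV[R]_n) :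
    set 'rV[R]_n :=
  [set x | exists (m : nat) (a : 'I_m -> 'rV[R]_n) (w : 'I_m -> R),
    [/\ forall i, A (a i), \sum_(i < m) w i = 1
      & x = \sum_(i < m) w i *: a i]].

Definition relint (R : realType) (n : nat) (A : set 'rV[R]_n) :
    set 'rV[R]_n :=
  [set x | A x /\ \forall y \near x, aff_hull A y -> A y].

(* Stated for an arbitrary set; on a polytope the extreme points are exactly
   its vertices. *)
Definition is_vertex (R : realType) (n : nat) (P : set 'rV[R]_n)
    (v : 'rV[R]_n) : Prop :=
  P v /\ forall (x y : 'rV[R]_n) (t : R), P x -> P y -> 0 < t < 1 ->
    v = (1 - t) *: x + t *: y -> x = v /\ y = v.

Definition integral_vec (R : realType) (n : nat) (v : 'rV[R]_n) : Prop :=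
  forall j, v ord0 j \is a Num.int.

Definition polytope (R : realType) (n : nat) (s : seq 'rV[R]_n) :
    set 'rV[R]_n :=
  conv_hull [set` s].

(* The dimension of the direction space of the affine hull of s, which is also
   the affine hull of polytope s and of its relative interior. The empty
   polytope gets dimension 0 rather than -1. *)
Definition polytope_dim (R : realType) (n : nat) (s : seq 'rV[R]_n) : nat :=
  \dim <<[seq x - y | x <- s, y <- s]>>%VS.

(* Disjointness is indexwise, so a nonempty cell cannot be listed twice. *)
Record ippcomplex (R : realType) (n : nat) := IPPComplex {
  ncells : nat;
  cell_points : 'I_ncells -> seq 'rV[R]_n;
  cells_integral : forall (i : 'I_ncells) (v : 'rV[R]_n),
    is_vertex (polytope (cell_points i)) v -> integral_vec v;
  cells_disjoint :
    trivIset [set: 'I_ncells] (fun i => relint (polytope (cell_points i)))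
}.

Definition complex_set (R : realType) (n : nat) (K : ippcomplex R n) :
    set 'rV[R]_n :=
  \bigcup_(i in [set: 'I_(ncells K)]) relint (polytope (cell_points i)).

(* A complex without cells has dimension 0 here; as dim K is only compared with
   natural numbers, this agrees with the conventions -1 and -oo. *)
Definition complex_dim (R : realType) (n : nat) (K : ippcomplex R n) : nat :=
  \max_(i < ncells K) polytope_dim (cell_points i).

Definition ehrhart (R : realType) (n : nat) (K : ippcomplex R n) (k : nat) :
    nat :=
  #|` fset_set ([set z : 'rV[R]_n | integral_vec z] `&`
                [set k%:R *: x | x in complex_set K])|%fset.

Definition is_ehrhart_poly (R : realType) (n : nat) (K : ippcomplex R n)
    (p : {poly R}) : Prop :=
  forall k : nat, (1 <= k)%N -> p.[k%:R] = (ehrhart K k)%:R.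

Definition gbinom (R : realType) (x : R) (i : nat) : R :=
  (\prod_(j < i) (x - j%:R)) / i`!%:R.

Definition is_fstar (R : realType) (p : {poly R}) (d : nat)
    (f : 'I_d.+1 -> R) : Prop :=
  (size p <= d.+1)%N /\
  forall x : R, p.[x] = \sum_(i < d.+1) f i * gbinom (x - 1) i.

Lemma is_ehrhart_poly_unique (R : realType) (n : nat) (K : ippcomplex R n)
    (p q : {poly R}) :
  is_ehrhart_poly K p -> is_ehrhart_poly K q -> p = q.
Proof.
move=> hp hq; apply/eqP; rewrite -subr_eq0; apply/negPn/negP => pq0.
pose rs := [seq (k.+1%:R : R) | k <- iota 0 (size (p - q))].
have := @max_poly_roots _ (p - q) rs pq0.
rewrite size_map size_iota ltnn => H; suff: false by [].
apply: H.
- apply/allP => _ /mapP[k _ ->].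
  by rewrite rootE hornerD hornerN hp// hq// subrr.
- rewrite map_inj_uniq ?iota_uniq// => a b /eqP.
  by rewrite eqr_nat eqSS => /eqP.
Qed.

Lemma gbinom_nat (R : realType) (m i : nat) :
  gbinom (m%:R : R) i = 'C(m, i)%:R.
Proof.
have i0 : (i`!%:R : R) != 0 by rewrite pnatr_eq0 -lt0n fact_gt0.
rewrite /gbinom; apply: (canLR (mulfK i0)); rewrite -natrM bin_ffact.
have [im|mi] := leqP i m.
  rewrite ffact_prod natr_prod; apply: eq_bigr => j _.
  by rewrite natrB// ltnW// (leq_trans (ltn_ord j)).
by rewrite ffact_small// (bigD1 (Ordinal mi))//= subrr mul0r.
Qed.

Lemma is_fstar_unique (R : realType) (p : {poly R}) (d : nat)
    (f g : 'I_d.+1 -> R) :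
  is_fstar p f -> is_fstar p g -> forall i, f i = g i.
Proof.
move=> [_ hf] [_ hg] [i]; elim/ltn_ind: i => i IH hi.
have := hf i.+1%:R; rewrite hg -natr1 addrK.
under eq_bigr do rewrite gbinom_nat.
under [RHS]eq_bigr do rewrite gbinom_nat.
rewrite (bigD1 (Ordinal hi))//= [RHS](bigD1 (Ordinal hi))//= binn !mulr1.
set S1 := (X in _ + X); set S2 := (X in _ = _ + X).
suff -> : S1 = S2 by move/addIr.
apply: eq_bigr => -[j hj]; rewrite -val_eqE /= => ji.
have [ij|lji] := ltnP i j; first by rewrite bin_small// !mulr0.
by rewrite IH// ltn_neqAle ji.
Qed.

(* Main.v *)
(* Weights l >= 0 representing a given point of the cone over a lattice polytope
   as a combination of the vertices can be chosen lexicographically maximal, and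
   then they are unique.  Both lexicographic maximality and membership of the
   point in the relative interior depend only on the support S of l, so no
   triangulation is needed: splitting l = p + f with f natural and p in (0, 1]
   on S puts the lattice points of the open k-th dilate in bijection with pairs
   (p, f), where p ranges over a finite set independent of k.  If p has integral
   height h, with 1 <= h <= |S|, there are C((k - 1) + (|S| - h), |S| - 1)
   choices of f, which by Vandermonde is a combination of the C(k - 1, i) with
   natural coefficients.  Conversely the open standard i-simplex has Ehrhart
   function C(k - 1, i), so disjoint translates of open standard simplices
   realize every vector of natural numbers. *)
Require Import Defs.
From mathcomp Require Import all_boot all_order all_algebra finmap.
From mathcomp Require Import all_classical all_reals topology normedtype.
From mathcomp Require Import lra zify.

Set Implicit Arguments.
Unset Strict Implicit.
Unset Printing Implicit Defensive.

Import Order.TTheory GRing.Theory Num.Theory.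
Import numFieldNormedType.Exports.

Local Open Scope classical_set_scope.
Local Open Scope ring_scope.

(** * Coordinate sums of weight vectors *)

Section Total.
Variables (R : realType) (m : nat).
Implicit Types l : 'rV[R]_m.

Definition total l : R := \sum_i l 0 i.

Lemma totalD l l' : total (l + l') = total l + total l'.
Proof. by rewrite /total -big_split; apply: eq_bigr => i _; rewrite mxE. Qed.

Lemma totalZ a l : total (a *: l) = a * total l.
Proof. by rewrite /total mulr_sumr; apply: eq_bigr => i _; rewrite mxE. Qed.

Lemma totalN l : total (- l) = - total l.
Proof. by rewrite -scaleN1r totalZ mulN1r. Qed.

Lemma total_sum (I : finType) (l : I -> 'rV[R]_m) :
  total (\sum_i l i) = \sum_i total (l i).
Proof.
rewrite /total exchange_big; apply: eq_bigr => i _ /=.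
by rewrite summxE.
Qed.

Lemma total_delta i : total (delta_mx 0 i) = 1.
Proof.
rewrite /total (bigD1 i)//= mxE !eqxx big1 ?addr0// => j ji.
by rewrite mxE (negPf ji) andbF.
Qed.

Lemma mulmx_ones l : l *m (const_mx 1 : 'cV_m) = const_mx (total l).
Proof.
apply/rowP => i; rewrite !mxE; apply: eq_bigr => j _.
by rewrite mxE mulr1.
Qed.

End Total.

(** * Polytopes: vertices, and weights for relative interiors *)

Section Polytopes.
Variables (R : realType) (n : nat).
Implicit Types (s : seq 'rV[R]_n) (x y : 'rV[R]_n).

Definition points s : 'M[R]_(size s, n) := \matrix_i s`_i.

Lemma row_points s i : delta_mx 0 i *m points s = s`_i.
Proof. by rewrite -rowE rowK. Qed.

Lemma mulmx_points s (l : 'rV_(size s)) :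
  l *m points s = \sum_i l 0 i *: s`_i.
Proof. by rewrite mulmx_sum_row; apply: eq_bigr => i _; rewrite rowK. Qed.

Lemma polytopeP s x : polytope s x <->
  exists l : 'rV_(size s),
    [/\ forall i, 0 <= l 0 i, total l = 1 & x = l *m points s].
Proof.
split=> [[m [a [w [as_ w0 w1 ->]]]]|[l [l0 l1 ->]]].
  have lt i : (index (a i) s < size s)%N by rewrite index_mem; exact: as_.
  exists (\sum_i w i *: delta_mx 0 (Ordinal (lt i))); split.
  - move=> i; rewrite summxE sumr_ge0// => j _.
    by rewrite !mxE mulr_ge0// ler0n.
  - rewrite total_sum -w1; apply: eq_bigr => i _.
    by rewrite totalZ total_delta mulr1.
  - rewrite mulmx_suml; apply: eq_bigr => i _.
    by rewrite -scalemxAl row_points nth_index//; exact: as_.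
exists (size s), (fun i => s`_i), (fun i => l 0 i); split => //.
- by move=> i /=; rewrite mem_nth.
- by rewrite mulmx_points.
Qed.

Lemma mem_polytope s x : x \in s -> polytope s x.
Proof.
move=> xs; exists 1%N, (fun=> x), (fun=> 1); split=> //.
- by rewrite big_ord1.
- by rewrite big_ord1 scale1r.
Qed.

Lemma polytope_convex s x y t : polytope s x -> polytope s y ->
  0 <= t <= 1 -> polytope s ((1 - t) *: x + t *: y).
Proof.
move=> /polytopeP[l [l0 l1 ->]] /polytopeP[k [k0 k1 ->]] /andP[t0 t1].
apply/polytopeP; exists ((1 - t) *: l + t *: k); split.
- by move=> i; rewrite !mxE addr_ge0// mulr_ge0// subr_ge0.
- by rewrite totalD !totalZ l1 k1; lra.
- by rewrite mulmxDl -!scalemxAl.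
Qed.

Lemma polytope_cons v s x : polytope (v :: s) x ->
  x = v \/ exists2 a : R, 0 <= a < 1 &
           exists2 y, polytope s y & x = a *: v + (1 - a) *: y.
Proof.
move=> /polytopeP[l [l0 l1 ->]].
have l1' : l 0 0 + \sum_(i < size s) l 0 (lift 0 i) = 1.
  by rewrite -l1 /total big_ord_recl.
have S0 : 0 <= \sum_(i < size s) l 0 (lift 0 i) by exact: sumr_ge0.
rewrite mulmx_points big_ord_recl /=.
have [l01|l01] := eqVneq (l 0 0) 1.
  have /eqP : \sum_(i < size s) l 0 (lift 0 i) = 0 by lra.
  rewrite psumr_eq0// => /allP ll; left.
  rewrite l01 scale1r big1 ?addr0// => i _.
  by have /eqP -> := ll i (mem_index_enum _); rewrite scale0r.
have la : l 0 0 < 1 by rewrite lt_neqAle l01; lra.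
have na : 1 - l 0 0 != 0 by rewrite subr_eq0 eq_sym.
right; exists (l 0 0); first by rewrite l0.
exists ((1 - l 0 0)^-1 *: \sum_(i < size s) l 0 (lift 0 i) *: s`_i).
  apply/polytopeP; exists (\row_i ((1 - l 0 0)^-1 * l 0 (lift 0 i))); split.
  - by move=> i; rewrite mxE mulr_ge0// invr_ge0 subr_ge0 ltW.
  - rewrite /total; under eq_bigr do rewrite mxE.
    rewrite -mulr_sumr; have -> : \sum_(i < size s) l 0 (lift 0 i) = 1 - l 0 0.
      by lra.
    by rewrite mulVf.
  - rewrite mulmx_points scaler_sumr; apply: eq_bigr => i _.
    by rewrite mxE scalerA.
by rewrite scalerA divff// scale1r.
Qed.

Lemma polytope_sub s t : {subset s <= t} -> polytope s `<=` polytope t.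
Proof.
move=> st x [m [a [w [as_ w0 w1 ->]]]]; exists m, a, w; split=> //.
by move=> i; exact/st/as_.
Qed.

Lemma eq_mem_polytope s t : s =i t -> polytope s = polytope t.
Proof.
move=> st; apply/seteqP; split; apply: polytope_sub => x; by rewrite st.
Qed.

Lemma polytope_cons_redundant v s : polytope s v ->
  polytope (v :: s) = polytope s.
Proof.
move=> sv; apply/seteqP; split => [x /polytope_cons[->//|]|].
  move=> [a /andP[a0 a1] [y sy ->]].
  have := @polytope_convex s v y (1 - a) sv sy.
  have -> : 1 - (1 - a) = a by lra.
  by apply; lra.
by apply: polytope_sub => x xs; rewrite inE xs orbT.
Qed.

(** If [v] lies strictly between two points of the hull, write both as mixtures of [v] and points of
    [polytope s] and solve for [v]: unless both points equal [v], this puts [v] in [polytope s]. *)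
Lemma irredundant_vertex v s : ~ polytope s v ->
  is_vertex (polytope (v :: s)) v.
Proof.
move=> nsv; split; first by apply: mem_polytope; rewrite mem_head.
move=> x y t vx vy /andP[t0 t1].
move/polytope_cons: vx => [->|[a /andP[a0 a1] [x' sx' ->]]].
  move/polytope_cons: vy => [->//|[b /andP[b0 b1] [y' sy' ->]]] E.
  exfalso; apply: nsv; suff -> : v = y' by [].
  have tb : t * (1 - b) != 0 by rewrite lt0r_neq0// mulr_gt0// subr_gt0.
  apply: (scalerI tb); rewrite -[RHS]addr0 -(subrr v).
  rewrite {3}E; apply/rowP => i; rewrite !mxE; lra.
move=> E; exfalso; apply: nsv.
(* The case [y = v] is absorbed as [b = 1], with [x'] as a dummy for [y']. *)
have [b [b0 b1] [y' sy' yE]] : exists2 b : R, 0 <= b /\ b <= 1 &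
    exists2 y', polytope s y' & y = b *: v + (1 - b) *: y'.
  move/polytope_cons: vy => [->|[b /andP[b0 b1] [y' sy' ->]]].
    exists 1; first by split.
    by exists x' => //; rewrite scale1r subrr scale0r addr0.
  exists b; first by split => //; exact: ltW.
  by exists y'.
(* These are the weights that [x'] and [y'] receive in [v]; cancelling the multiples of [v] leaves
   [(c + e) *: v = c *: x' + e *: y'], and [c > 0] even if [b = 1]. *)
have c0 : 0 < (1 - t) * (1 - a) by rewrite mulr_gt0// subr_gt0.
have e0 : 0 <= t * (1 - b) by rewrite mulr_ge0// ?subr_ge0// ltW.
set c := (1 - t) * (1 - a) in c0; set e := t * (1 - b) in e0.
have ce : 0 < c + e by lra.
have vE : (c + e) *: v = c *: x' + e *: y'.
  rewrite -[LHS]addr0 -(subrr v) {2}E yE /c /e.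
  by apply/rowP => i; rewrite !mxE; lra.
have -> : v = (1 - e / (c + e)) *: x' + (e / (c + e)) *: y'.
  apply: (scalerI (lt0r_neq0 ce)); rewrite vE scalerDr !scalerA.
  have -> : (c + e) * (1 - e / (c + e)) = c.
    by rewrite mulrBr mulr1 mulrCA divff ?lt0r_neq0// mulr1 addrK.
  by rewrite mulrCA divff ?lt0r_neq0// mulr1.
apply: polytope_convex => //.
by rewrite divr_ge0 ?(ltW ce)//= ler_pdivrMr// mul1r; lra.
Qed.

(** A vertex other than [u] puts no weight on [u]: otherwise it would lie strictly between [u] and a
    point of [polytope s]. So it is a vertex of the smaller hull. *)
Lemma vertex_mem s v : is_vertex (polytope s) v -> v \in s.
Proof.
elim: s v => [v [/polytopeP[l [_ + _]] _]|u s IH v [uv vv]].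
  by rewrite /total big_ord0 => /esym/eqP; rewrite oner_eq0.
have sub : polytope s `<=` polytope (u :: s).
  by apply: polytope_sub => x xs; rewrite inE xs orbT.
rewrite inE; have [-> //|vu] := eqVneq v u.
have vs : polytope s v.
  move/polytope_cons: (uv) => [E|[a /andP[a0 a1] [y sy E]]].
    by rewrite E eqxx in vu.
  move: a0; rewrite le_eqVlt => /predU1P[a0|a0].
    by rewrite E -a0 scale0r add0r subr0 scale1r.
  have [|||//|yv uv'] := vv y u a.
  - exact: sub.
  - by apply: mem_polytope; rewrite mem_head.
  - by rewrite a0.
  - by rewrite E addrC.
  - by rewrite uv' eqxx in vu.
by apply/IH; split=> // x y t sx sy; apply: vv; exact: sub.
Qed.

(** A complex only constrains the vertices of its cells, so the listed points may be non-integral.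
    Discarding redundant points one by one leaves only vertices, by [irredundant_vertex]. *)
Lemma polytope_vertices s : exists t : seq 'rV[R]_n,
  polytope t = polytope s /\ forall v, v \in t -> is_vertex (polytope s) v.
Proof.
have [N] := ubnP (size s); elim: N s => // N IH s sN.
have [[v [vs rv]]|irr] := pselect (exists v, v \in s /\ polytope (rem v s) v).
  have sE : polytope s = polytope (rem v s).
    by rewrite -(polytope_cons_redundant rv); apply/eq_mem_polytope/perm_mem/perm_to_rem.
  rewrite sE; apply: IH; rewrite size_rem//.
  by case: s sN vs {rv sE}.
exists s; split=> // v vs.
rewrite (eq_mem_polytope (perm_mem (perm_to_rem vs))).
by apply: irredundant_vertex => rv; apply: irr; exists v.
Qed.

Lemma aff_hull_polytope s y : aff_hull (polytope s) y ->
  exists2 b : 'rV_(size s), total b = 1 & y = b *m points s.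
Proof.
move=> [m [a [w [/= as_ w1 ->]]]].
have /choice[l lP] : forall i, exists l : 'rV_(size s),
    total l = 1 /\ a i = l *m points s.
  by move=> i; have /polytopeP[l [_ l1 E]] := as_ i; exists l.
exists (\sum_i w i *: l i).
  rewrite total_sum -w1; apply: eq_bigr => i _.
  by rewrite totalZ (lP i).1 mulr1.
rewrite mulmx_suml; apply: eq_bigr => i _.
by rewrite -scalemxAl (lP i).2.
Qed.

(** Each row is lifted to height 1, so that the image of a weight vector records its total as well
    as its point: this is the cone over the rows of [A]. *)
Definition homog m (A : 'M[R]_(m, n)) : 'M[R]_(m, n + 1) :=
  row_mx A (const_mx 1).

Lemma mul_homog m (l : 'rV_m) (A : 'M[R]_(m, n)) :
  l *m homog A = row_mx (l *m A) (const_mx (total l)).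
Proof. by rewrite mul_mx_row mulmx_ones. Qed.

Lemma eq_homog m (l l' : 'rV_m) (A : 'M[R]_(m, n)) :
  l *m homog A = l' *m homog A <-> l *m A = l' *m A /\ total l = total l'.
Proof.
rewrite !mul_homog; split=> [/eq_row_mx[-> /rowP/(_ 0)]|[-> ->]//].
by rewrite !mxE.
Qed.

Lemma mulmx_small m q (B : 'M[R]_(q, m)) (e : R) : 0 < e ->
  exists2 r : R, 0 < r & forall u : 'rV_q,
    (forall j, `|u 0 j| < r) -> forall i, `|(u *m B) 0 i| < e.
Proof.
move=> e0; pose C := 1 + \sum_i \sum_j `|B i j|.
have C0 : 0 < C by rewrite ltr_pwDl// sumr_ge0// => i _; exact: sumr_ge0.
exists (e / C); first exact: divr_gt0.
move=> u ur i; rewrite mxE; apply: le_lt_trans (ler_norm_sum _ _ _) _.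
have eC : e = e / C * C by rewrite divfK// lt0r_neq0.
have CB : \sum_j `|B j i| < C.
  rewrite /C ltr_pwDl// ler_sum// => j _.
  by rewrite (bigD1 i)//= lerDl sumr_ge0.
apply: (@le_lt_trans _ _ (e / C * \sum_j `|B j i|)).
  rewrite mulr_sumr ler_sum// => j _; rewrite normrM ler_wpM2r//; exact/ltW/ur.
by rewrite [ltRHS]eC ltr_pM2l// divr_gt0.
Qed.

(* A point [y] of the affine hull near [x] need not come with weights near those
   of [x]; the linear section [pinvmx] provides such weights. *)
Lemma relint_polytopeP s x : relint (polytope s) x <->
  exists l : 'rV_(size s),
    [/\ forall i, 0 < l 0 i, total l = 1 & x = l *m points s].
Proof.
split=> [[sx /nbhs_ballP[e /= e0 xe]]|[l [l0 l1 xE]]].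
  have [l [l0 l1 xE]] := (polytopeP s x).1 sx.
  have s0 : (0 < size s)%N.
    rewrite lt0n; apply/eqP => s0; move: l1; rewrite /total big1.
      by move/esym/eqP; rewrite oner_eq0.
    by move=> i; have := ltn_ord i; lia.
  (* Push [x] slightly away from the barycenter, inside the polytope; then [x] is a mixture of the
     pushed point and the barycenter, whose weights are all positive. *)
  pose b : 'rV[R]_(size s) := const_mx (size s)%:R^-1.
  have sR : (size s)%:R != 0 :> R by rewrite pnatr_eq0 -lt0n.
  have bp i : 0 < b 0 i by rewrite mxE invr_gt0 ltr0n.
  have b1 : total b = 1.
    rewrite /total; under eq_bigr do rewrite mxE.
    by rewrite sumr_const card_ord -[LHS]mulr_natl mulfV.
  have [u uE] : exists u, u = x - b *m points s by eexists.
  have [r r0 hr] := @mulmx_small _ _ (u : 'M_(1, n)) e e0.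
  pose t := r / 2; have t0 : 0 < t by rewrite divr_gt0.
  have tr : t < r by rewrite /t ltr_pdivrMr//; lra.
  have : polytope s (x + t *: u).
    apply: xe.
      split=> // i j; rewrite ord1 /ball /= !mxE opprD addNKr normrN.
      have := hr (const_mx t) _ j; rewrite !mxE big_ord1 !mxE.
      by apply => k; rewrite mxE gtr0_norm.
    (* These weights may be negative; they only witness membership in the affine hull. *)
    exists (size s), (fun i => s`_i), (fun i => (l + t *: (l - b)) 0 i).
    split.
    - by move=> i; apply: mem_polytope; rewrite mem_nth.
    - by rewrite -/(total _) totalD totalZ totalD totalN l1 b1 subrr mulr0 addr0.
    - by rewrite -mulmx_points mulmxDl -scalemxAl mulmxBl -xE uE.
  move=> /polytopeP[c [c0 c1 cE]].
  exists ((1 + t)^-1 *: (c + t *: b)); split.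
  - move=> i; rewrite mxE mulr_gt0 ?invr_gt0 ?addr_gt0// mxE ltr_wpDl//.
    by rewrite mxE mulr_gt0.
  - by rewrite totalZ totalD totalZ c1 b1 mulr1 mulVf// lt0r_neq0// addr_gt0.
  - have t1 : 1 + t != 0 by rewrite lt0r_neq0// addr_gt0.
    apply: (scalerI t1); rewrite -scalemxAl scalerA divff// scale1r.
    rewrite mulmxDl -scalemxAl -cE uE.
    by apply/rowP => i; rewrite !mxE; lra.
split.
  by apply/polytopeP; exists l; split => // i; exact: ltW.
have [e e0 le] : exists2 e : R, 0 < e & forall i, e <= l 0 i.
  exists (\big[Num.min/1]_i l 0 i); first by apply: lt_bigmin.
  by move=> i; exact: bigmin_le.
pose H := homog (points s).
have [r r0 hr] := mulmx_small (pinvmx H) e0.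
apply/nbhs_ballP; exists r => //= y xy /aff_hull_polytope[b b1 yE].
have E : row_mx (y - x) 0 = (b - l) *m H.
  by rewrite mul_homog mulmxBl -yE -xE totalD totalN b1 l1 subrr.
pose g := row_mx (y - x) 0 *m pinvmx H.
have gE : g *m H = row_mx (y - x) 0.
  by rewrite mulmxKpV// E submxMl.
have [gA gt] : g *m points s = y - x /\ total g = 0.
  move: gE; rewrite mul_homog => /eq_row_mx[-> /rowP/(_ 0)].
  by rewrite !mxE.
apply/polytopeP; exists (l + g); split.
- move=> i; rewrite mxE; suff : `|g 0 i| < e.
    by rewrite ltr_norml => /andP[+ _]; have := le i; lra.
  apply: hr => j; rewrite mxE; case: fintype.split => k; last by rewrite mxE normr0.
  have /(_ 0 k) := xy.2; rewrite /ball /= !mxE.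
  by rewrite distrC.
- by rewrite totalD l1 gt addr0.
- by rewrite mulmxDl -xE gA addrC subrK.
Qed.

Lemma scaled_relintP s k z : (0 < k)%N ->
  (exists2 x, relint (polytope s) x & k%:R *: x = z) <->
  exists l : 'rV_(size s),
    [/\ forall i, 0 < l 0 i, total l = k%:R & z = l *m points s].
Proof.
move=> k0; have k0R : 0 < k%:R :> R by rewrite ltr0n.
split=> [[x /relint_polytopeP[l [l0 l1 ->]] <-]|[l [l0 l1 ->]]].
  exists (k%:R *: l); split.
  - by move=> i; rewrite mxE mulr_gt0.
  - by rewrite totalZ l1 mulr1.
  - by rewrite scalemxAl.
exists (k%:R^-1 *: (l *m points s)); last first.
  by rewrite scalerA divff ?scale1r// lt0r_neq0.
apply/relint_polytopeP; exists (k%:R^-1 *: l); split.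
- by move=> i; rewrite mxE mulr_gt0// invr_gt0.
- by rewrite totalZ l1 mulVf// lt0r_neq0.
- by rewrite scalemxAl.
Qed.

End Polytopes.

(** * Lexicographically maximal nonnegative representations *)

Section LexmaxRepresentation.
Variables (R : realType) (m q : nat) (B : 'M[R]_(m, q)).
Hypothesis total_ker : forall u : 'rV_m, u *m B = 0 -> total u = 0.
Implicit Types l u : 'rV[R]_m.

Definition supp l : {set 'I_m} := [set i | l 0 i != 0].

Definition lexpos u : Prop :=
  exists2 i : 'I_m, 0 < u 0 i & forall j : 'I_m, (j < i)%N -> u 0 j = 0.

Lemma lexposVN u : u != 0 -> lexpos u \/ lexpos (- u).
Proof.
move=> u0.
have [k uk] : exists k, u 0 k != 0.
  apply/existsP; rewrite -negb_forall; apply: contra u0 => /forallP u0.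
  by apply/eqP/rowP => i; rewrite mxE; apply/eqP.
case: (@arg_minnP _ k (fun i => u 0 i != 0) (fun i => nat_of_ord i) uk).
move=> i ui imin.
have z (j : 'I_m) : (j < i)%N -> u 0 j = 0.
  by move=> ji; apply/eqP/negPn/negP => /imin; rewrite leqNgt ji.
have [u0'|u0'] := ltP 0 (u 0 i); [left|right]; exists i => //.
  by rewrite mxE oppr_gt0 lt_neqAle ui.
by move=> j /z uj; rewrite mxE uj oppr0.
Qed.

Lemma lexposD u v : lexpos u -> lexpos v -> lexpos (u + v).
Proof.
move=> [i ui zi] [j vj zj].
have [ij|ji|/val_inj ij] := ltngtP i j.
- exists i; first by rewrite mxE zj// addr0.
  by move=> k ki; rewrite mxE zi// zj ?addr0// (ltn_trans ki).
- exists j; first by rewrite mxE zi// add0r.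
  by move=> k ki; rewrite mxE zj// zi ?addr0// (ltn_trans ki).
- exists i; first by rewrite mxE addr_gt0// ij.
  by move=> k ki; rewrite mxE zi// zj ?addr0// -ij.
Qed.

Lemma lexposZ a u : 0 < a -> lexpos u -> lexpos (a *: u).
Proof.
move=> a0 [i ui zi]; exists i; first by rewrite mxE mulr_gt0.
by move=> j ji; rewrite mxE zi// mulr0.
Qed.

Lemma lexpos0 : ~ lexpos 0.
Proof. by move=> [i]; rewrite mxE ltxx. Qed.

(** Take the least ratio of [l 0 i] to [1 + |u 0 i|]; the added 1 avoids a zero denominator and
    makes the inequality strict. *)
Lemma pos_perturb l u : exists2 e : R, 0 < e &
  forall i, 0 < l 0 i -> 0 < l 0 i + e * u 0 i.
Proof.
pose f i := l 0 i / (1 + `|u 0 i|).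
have d0 i : 0 < 1 + `|u 0 i| by rewrite ltr_pwDl.
exists (\big[Num.min/1]_(i | 0 < l 0 i) f i).
  by apply: lt_bigmin => // i li; exact: divr_gt0.
move=> i li; set e := \big[_/_]_(_ | _) _.
have e0 : 0 < e by apply: lt_bigmin => // j lj; exact: divr_gt0.
have : e <= f i by exact: bigmin_le_cond.
rewrite /f ler_pdivlMr// mulrDr mulr1 => h.
have : - (e * `|u 0 i|) <= e * u 0 i.
  by rewrite -mulrN ler_wpM2l ?(ltW e0)// lerNnormlW.
by lra.
Qed.

(** For nonnegative [l] with support [S], the directions [u] quantified over are those along which a
    small move keeps [l] nonnegative and [l *m B] fixed. Hence the condition is lexicographic
    maximality of [l] in its fibre, expressed through the support alone. *)
Definition lexmax_supp (S : {set 'I_m}) : Prop := forall u,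
  u *m B = 0 -> (forall i, i \notin S -> 0 <= u 0 i) -> ~ lexpos u.

Definition interior_supp (S : {set 'I_m}) : Prop := exists2 u : 'rV[R]_m,
  u *m B = 0 & forall i, i \notin S -> 0 < u 0 i.

(** The rows of [B] indexed by the support are linearly independent, as for basic solutions in
    linear programming. *)
Definition basic l : Prop := forall u,
  u *m B = 0 -> supp u \subset supp l -> u = 0.

Lemma supp_gt0 l i : (forall i, 0 <= l 0 i) -> i \in supp l -> 0 < l 0 i.
Proof. by move=> l0; rewrite inE lt_neqAle l0 eq_sym => ->. Qed.

Lemma notin_supp l i : i \notin supp l -> l 0 i = 0.
Proof. by rewrite inE negbK => /eqP. Qed.

(** If [l] and [l'] differ, one of [l - l'] and [l' - l] is lexicographically positive; the first is
    an admissible direction at [l'], the second at [l]. *)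
Lemma lexmax_unique l l' : (forall i, 0 <= l 0 i) -> (forall i, 0 <= l' 0 i) ->
  l *m B = l' *m B -> lexmax_supp (supp l) -> lexmax_supp (supp l') -> l = l'.
Proof.
move=> l0 l'0 E ml ml'; apply/eqP; rewrite -subr_eq0; apply/negPn/negP.
case/lexposVN; [apply: ml'|apply: ml].
- by rewrite mulmxBl E subrr.
- by move=> i /notin_supp l'i; rewrite !mxE l'i subr0.
- by rewrite mulNmx mulmxBl E subrr oppr0.
- by move=> i /notin_supp l'i; rewrite !mxE l'i sub0r opprK.
Qed.

(** The difference of the two weight vectors is a direction as required; conversely, a small step
    from [l] along such a direction makes every weight positive. *)
Lemma interior_suppP l : (forall i, 0 <= l 0 i) ->
  (exists2 l' : 'rV[R]_m, forall i, 0 < l' 0 i & l' *m B = l *m B) <->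
  interior_supp (supp l).
Proof.
move=> l0; split=> [[l' l'0 E]|[u uB u0]].
  exists (l' - l); first by rewrite mulmxBl E subrr.
  by move=> i /notin_supp li; rewrite !mxE li subr0.
have [e e0 he] := pos_perturb l u.
exists (l + e *: u); last by rewrite mulmxDl -scalemxAl uB scaler0 addr0.
move=> i; rewrite !mxE; have [il|il] := boolP (i \in supp l).
  exact/he/supp_gt0.
by rewrite (notin_supp il) add0r mulr_gt0// u0.
Qed.

(** A nonnegative vector of total 0 vanishes. So the fibres of nonnegative weights contain no ray,
    and moving along [u] must end. *)
Lemma ker_has_neg u : u *m B = 0 -> u != 0 -> exists i, u 0 i < 0.
Proof.
move=> /total_ker u0 nz; apply: contrapT => h.
have up i : 0 <= u 0 i by rewrite leNgt; apply/negP => ui; apply: h; exists i.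
case/eqP: nz; apply/rowP => i; rewrite mxE.
move/eqP: u0; rewrite /total psumr_eq0// => /allP/(_ i (mem_index_enum _)).
by move/eqP.
Qed.

(* Move along [u] until the first coordinate vanishes. *)
Lemma shrink_supp l u : (forall i, 0 <= l 0 i) ->
  supp u \subset supp l -> (exists i, u 0 i < 0) ->
  exists2 t : R, 0 < t &
    (forall i, 0 <= (l + t *: u) 0 i) /\ supp (l + t *: u) \proper supp l.
Proof.
move=> l0 ul [i0 ui0].
pose f i := l 0 i / - u 0 i.
case: (@arg_minP _ _ _ i0 (fun i => u 0 i < 0) f ui0) => i ui imin.
have nu : 0 < - u 0 i by rewrite oppr_gt0.
have il : i \in supp l.
  by apply: (fintype.subsetP ul); rewrite inE lt_eqF.
have t0 : 0 < f i by rewrite divr_gt0// supp_gt0.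
exists (f i) => //; split=> [j|].
  rewrite !mxE; have [uj|uj] := ltP (u 0 j) 0; last first.
    by rewrite addr_ge0// mulr_ge0// ltW.
  have := imin _ uj; rewrite {2}/f ler_pdivlMr ?oppr_gt0//.
  by rewrite mulrN lerNl -subr_ge0 opprK addrC.
apply/fintype.properP; split.
  apply/fintype.subsetP => j; rewrite [in X in X -> _]inE !mxE.
  apply: contraR => jl; rewrite (notin_supp jl) add0r.
  have /notin_supp -> : j \notin supp u by apply: contra jl; exact: (fintype.subsetP ul).
  by rewrite mulr0.
exists i => //; rewrite inE negbK !mxE /f mulrAC invrN mulrN.
by rewrite mulfK ?subrr// lt_eqF.
Qed.

(** A dependency within the support, with its sign chosen lexicographically positive, gives a
    direction that improves [l] until a coordinate is lost; induct on the size of the support. *)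
Lemma improve_to_basic l : (forall i, 0 <= l 0 i) ->
  exists l', [/\ forall i, 0 <= l' 0 i, l' *m B = l *m B, basic l'
               & l' = l \/ lexpos (l' - l)].
Proof.
have [N] := ubnP #|supp l|; elim: N l => // N IH l lN l0.
have [bl|] := pselect (basic l); first by exists l; split => //; left.
move=> /existsNP[u0 /not_implyP[u0B /not_implyP[u0l u0n]]].
have [u [uB ul lu]] : exists u, [/\ u *m B = 0, supp u \subset supp l & lexpos u].
  case: (@lexposVN u0); first exact/eqP.
  - by exists u0.
  - move=> lu; exists (- u0); split=> //; first by rewrite mulNmx u0B oppr0.
    by apply: fintype.subset_trans u0l; apply/fintype.subsetP => i; rewrite !inE mxE oppr_eq0.
have un : u != 0 by apply/eqP => u_0; apply: lexpos0; rewrite -u_0.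
have [t t0 [lt0 ltl]] := shrink_supp l0 ul (ker_has_neg uB un).
have [||l' [l'0 l'B bl' l'l]] := IH (l + t *: u) => //.
  exact: leq_trans (proper_card ltl) _.
have tu := lexposZ t0 lu.
exists l'; split=> //.
  by rewrite l'B mulmxDl -scalemxAl uB scaler0 addr0.
right; case: l'l => [->|h]; first by rewrite addrAC subrr add0r.
have -> : l' - l = (l' - (l + t *: u)) + t *: u by rewrite opprD addrA subrK.
exact: lexposD.
Qed.

(** Injectivity of [f] makes [P] finite, and a maximum is found by running through the values of
    [f]. *)
Lemma exists_lexmax_of_inj (T : finType) (P : 'rV[R]_m -> Prop)
    (f : 'rV[R]_m -> T) :
  (forall x y, P x -> P y -> f x = f y -> x = y) ->
  (exists x : 'rV[R]_m, P x) ->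
  exists2 x : 'rV[R]_m, P x & forall y, P y -> ~ lexpos (y - x).
Proof.
move=> finj [x0 Px0].
suff max (s : seq T) : (exists2 x : 'rV[R]_m, P x & f x \in s) -> exists2 x : 'rV[R]_m, P x &
    forall y, P y -> f y \in s -> ~ lexpos (y - x).
  have [|x Px xmax] := max (enum T); first by exists x0; rewrite ?mem_enum.
  by exists x => // y Py; apply: xmax; rewrite ?mem_enum.
elim: s => [[]//|a s IH ex].
(* If no member has its value in [s], those considered all have value [a] and coincide; otherwise
   the maximum [x1] over [s] competes with a possible member of value [a]. *)
have [/IH[x1 Px1 x1max]|none] := pselect (exists2 x : 'rV[R]_m, P x & f x \in s); last first.
  have [x Px xs] := ex; exists x => // y Py ys.
  have hd z : P z -> f z \in a :: s -> f z = a.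
    by move=> Pz; rewrite inE => /predU1P[//|zs]; case: none; exists z.
  have -> : y = x by apply: finj => //; rewrite (hd _ Px xs) (hd _ Py ys).
  by rewrite subrr; exact: lexpos0.
have [[x [Px xa xx1]]|none] :=
    pselect (exists x, [/\ P x, f x = a & lexpos (x - x1)]).
  exists x => // y Py; rewrite inE => /predU1P[ya|ys].
    have -> : y = x by apply: finj => //; rewrite ya.
    by rewrite subrr; exact: lexpos0.
  move=> yx; apply: (x1max _ Py ys).
  by rewrite -(subrK x y) -addrA; exact: lexposD.
exists x1 => // y Py; rewrite inE => /predU1P[ya|ys]; last exact: x1max.
by move=> yx1; apply: none; exists y.
Qed.

(** Basic vectors of a fibre are determined by their supports, so a largest one exists. It is
    maximal in the whole fibre, since any improvement could be improved further to a basic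
    vector. *)
Lemma lexmax_exists l : (forall i, 0 <= l 0 i) ->
  exists l', [/\ forall i, 0 <= l' 0 i, l' *m B = l *m B
               & lexmax_supp (supp l')].
Proof.
move=> l0.
pose P l' := [/\ forall i, 0 <= l' 0 i, l' *m B = l *m B & basic l'].
have Pinj x y : P x -> P y -> supp x = supp y -> x = y.
  move=> [_ xB bx] [_ yB _] xy; apply/eqP; rewrite -subr_eq0; apply/eqP.
  apply: bx; first by rewrite mulmxBl xB yB subrr.
  apply/fintype.subsetP => i; rewrite inE; apply: contraR => ix.
  by rewrite !mxE (notin_supp ix) (@notin_supp y i) -?xy// subrr.
have [|x [x0 xB bx] xmax] := exists_lexmax_of_inj Pinj.
  by have [l' [? ? ? _]] := improve_to_basic l0; exists l'.
exists x; split=> // u uB u0 lu.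
have [e e0 he] := pos_perturb x u.
have [|y [y0 yB by_ yx]] := @improve_to_basic (x + e *: u).
  move=> i; rewrite !mxE; have [ix|ix] := boolP (i \in supp x).
    exact/ltW/he/supp_gt0.
  by rewrite (notin_supp ix) add0r mulr_ge0 ?(ltW e0)// u0.
apply: (xmax y).
  by split=> //; rewrite yB mulmxDl -scalemxAl uB scaler0 addr0.
have eu := lexposZ e0 lu.
case: yx => [->|h]; first by rewrite addrAC subrr add0r.
have -> : y - x = (y - (x + e *: u)) + e *: u by rewrite opprD addrA subrK.
exact: lexposD.
Qed.

End LexmaxRepresentation.

(** * Weak compositions, cardinalities and binomial expansions *)

Section Counting.

Lemma card_weak_compositions (m k h : nat) (S : {set 'I_m}) :
  (0 < k)%N -> (0 < h <= #|S|)%N ->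
  #|[set f : {ffun 'I_m -> 'I_k.+1} |
      [forall i, (i \notin S) ==> (f i == 0 :> nat)]
      && (h + \sum_i f i == k)%N]%SET| = 'C(k.-1 + (#|S| - h), #|S|.-1).
Proof.
move=> k0 /andP[h0 hS].
have [kh|hk] := ltnP k h.
  rewrite bin_small; last by lia.
  apply/eqP; rewrite cards_eq0; apply/eqP/finset.setP => f; rewrite !inE.
  by apply/negP => /andP[_ /eqP]; lia.
have [s Ss] : exists s, #|S| = s.+1 by exists #|S|.-1; lia.
have [r kr] : exists r, k = (h + r)%N by exists (k - h)%N; lia.
have sS : size (enum S) = s.+1 by rewrite -cardE.
(* Enumerating [S] turns the tuples of sum [r = k - h], counted by [card_ord_partitions], into
   functions supported on [S]. *)
pose phi (t : s.+1.-tuple 'I_r.+1) : {ffun 'I_m -> 'I_k.+1} :=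
  [ffun i => if i \in S then inord (nth ord0 t (index i (enum S))) else ord0].
have phiE t i : i \in S -> phi t i = nth ord0 t (index i (enum S)) :> nat.
  by move=> iS; rewrite ffunE iS inordK// (leq_trans (ltn_ord _))// kr; lia.
have idx i : i \in S -> (index i (enum S) < s.+1)%N.
  by move=> iS; rewrite -sS index_mem mem_enum.
have sumE (F : 'I_m -> nat) : (forall i, i \notin S -> F i = 0)%N ->
    (\sum_i F i = \sum_(i <- enum S) F i)%N.
  move=> F0; rewrite big_enum (bigID (mem S))/= [X in (_ + X)%N]big1 ?addn0//.
have -> : 'C(k.-1 + (#|S| - h), #|S|.-1) = 'C(s + r, s).
  by rewrite Ss kr /=; congr 'C(_, _); lia.
rewrite -card_ord_partitions -(card_imset _ (f := phi)); last first.
  move=> t t' tt'; apply/val_inj/(@eq_from_nth _ ord0).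
    by rewrite !size_tuple.
  move=> j; rewrite size_tuple => js'; apply/val_inj => /=.
  have js : (j < size (enum S))%N by rewrite sS.
  have e0 : 'I_m by case: (enum S) sS => // a.
  have jS : nth e0 (enum S) j \in S by rewrite -mem_enum mem_nth.
  by have := phiE t _ jS; rewrite tt' phiE// index_uniq ?enum_uniq.
apply: eq_card => f; rewrite !inE; apply/andP/imsetP; last first.
  move=> [t]; rewrite inE => /eqP tr ->; split.
    by apply/forallP => i; apply/implyP => /negPf iS; rewrite ffunE iS.
  apply/eqP; rewrite sumE; last first.
    by move=> i /negPf iS; rewrite ffunE iS.
  rewrite [RHS]kr; congr addn; rewrite -[RHS]tr.
  have e0 : 'I_m by case: (enum S) sS => // a.
  rewrite (big_nth e0) [RHS](big_nth ord0) size_tuple sS !big_nat.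
  apply: eq_bigr => j /andP[_ js]; rewrite phiE.
    by rewrite index_uniq ?enum_uniq// sS.
  by rewrite -mem_enum mem_nth// sS.
move=> [/forallP f0 /eqP fk].
have f0' i : i \notin S -> f i = 0 :> nat by move=> iS; exact/eqP/(implyP (f0 i)).
have fr i : (f i < r.+1)%N.
  have fi : (f i <= \sum_i f i)%N by rewrite (bigD1 i)//= leq_addr.
  by rewrite ltnS -(leq_add2l h) -kr -[X in (_ <= X)%N]fk leq_add2l.
have sz : size [seq (inord (f i) : 'I_r.+1) | i <- enum S] == s.+1.
  by rewrite size_map sS.
exists (Tuple sz).
  rewrite inE /= big_map; apply/eqP; under eq_bigr do rewrite inordK//.
  by rewrite -sumE//; lia.
apply/ffunP => i; apply/val_inj => /=.
have [iS|iS] := boolP (i \in S).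
  rewrite phiE//= (nth_map i) ?sS ?idx// inordK//.
  by rewrite nth_index ?mem_enum.
by rewrite ffunE (negPf iS) f0'.
Qed.

Lemma card_fset_set_image (T : finType) (U : choiceType) (D : {set T})
    (f : T -> U) : {in D &, injective f} ->
  #|` fset_set [set f x | x in [set` D]]|%fset = #|D|.
Proof.
move=> finj.
have -> : [set f x | x in [set` D]] = [set` [fset f x | x in D]%fset].
  apply/seteqP; split=> y /=.
    by move=> [x /= xD <-]; apply/imfsetP; exists x.
  by move=> /imfsetP[x /= xD ->]; exists x.
by rewrite set_fsetK card_in_imfset//= -cardE.
Qed.

Lemma card_fset_set_bigcup (T : choiceType) (N : nat) (F : 'I_N -> set T) :
  (forall i, finite_set (F i)) -> trivIset setT F ->
  #|` fset_set (\bigcup_(i in setT) F i)|%fset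
  = (\sum_i #|` fset_set (F i)|%fset)%N.
Proof.
move=> Ffin Ftriv.
(* [G] extends the family to all natural indices by empty sets, to fit [trivIset_sum_card]. *)
pose G k := \bigcup_(i in [set i : 'I_N | i = k :> nat]) F i.
have GF (i : 'I_N) : G i = F i.
  apply/seteqP; split=> [x [j /= /val_inj -> //]|x Fx].
  by exists i.
have -> : \bigcup_(i in setT) F i = \big[setU/set0]_(k < N) G k.
  rewrite -bigcup_mkord; apply/seteqP; split=> x.
    by move=> [i _ Fx]; exists (i : nat) => /=; rewrite ?ltn_ord// GF.
  by move=> [k /= kN [i /= _ Fx]]; exists i.
rewrite -trivIset_sum_card.
- by apply: eq_bigr => i _; rewrite GF.
- by move=> k; apply: bigcup_finite.
- move=> a b _ _ [x [[i /= <- Fix] [j /= <- Fjx]]].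
  by congr nat_of_ord; apply: Ftriv => //; exists x.
Qed.

(* [f k] expands with natural coefficients in the basis ['C(k - 1, i)]; the
   argument is shifted to avoid the predecessor. *)
Definition fstar_nat (f : nat -> nat) : Prop :=
  exists a : nat -> nat, forall k, f k.+1 = (\sum_(i < k.+1) a i * 'C(k, i))%N.

Lemma fstar_nat_sum (I : finType) (f : I -> nat -> nat) :
  (forall i, fstar_nat (f i)) -> fstar_nat (fun k => \sum_i f i k)%N.
Proof.
move=> /choice[a aP]; exists (fun j => \sum_i a i j)%N => k.
under eq_bigr do rewrite aP.
by rewrite exchange_big; apply: eq_bigr => j _; rewrite big_distrl.
Qed.

Lemma sum_ord_support (V : nmodType) (N M : nat) (F : nat -> V) :
  (forall j, (N <= j)%N -> F j = 0) -> (N <= M)%N ->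
  \sum_(j < N) F j = \sum_(j < M) F j.
Proof.
move=> F0 NM; rewrite (big_ord_widen M F NM) big_mkcond.
by apply: eq_bigr => j _; case: ltnP => // /F0.
Qed.

Lemma fstar_nat_bin (e s : nat) : fstar_nat (fun k => 'C(k.-1 + e, s)).
Proof.
(* The test is essential: for [i > s] the truncated [s - i] would give the coefficient 1. *)
exists (fun i => if (i <= s)%N then 'C(e, s - i) else 0)%N => k /=.
rewrite -binomial.Vandermonde.
have -> : (\sum_(j < s.+1) 'C(k, j) * 'C(e, s - j) =
    \sum_(j < s.+1) (if j <= s then 'C(e, s - j) else 0) * 'C(k, j))%N.
  by apply: eq_bigr => j _; rewrite -ltnS ltn_ord mulnC.
(* The terms vanish beyond [s] and beyond [k], so the sums of lengths [s.+1] and [k.+1] are both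
   extended to a common length. *)
pose F j := ((if j <= s then 'C(e, s - j) else 0) * 'C(k, j))%N.
rewrite (@sum_ord_support _ s.+1 (s.+1 + k.+1) F) ?leq_addr//; last first.
  by move=> j; rewrite /F ltnNge => /negPf ->.
rewrite (@sum_ord_support _ k.+1 (s.+1 + k.+1) F) ?leq_addl//.
by move=> j jk; rewrite /F (bin_small jk) muln0.
Qed.

End Counting.

(** * Integral vectors and natural parts *)

Section IntegralVectors.
Variable R : realType.

Lemma integral_vecD n (u v : 'rV[R]_n) :
  integral_vec u -> integral_vec v -> integral_vec (u + v).
Proof. by move=> hu hv j; rewrite mxE rpredD. Qed.

Lemma integral_vecB n (u v : 'rV[R]_n) :
  integral_vec u -> integral_vec v -> integral_vec (u - v).
Proof. by move=> hu hv j; rewrite !mxE rpredB. Qed.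

Lemma integral_vecM m n (u : 'rV[R]_m) (B : 'M[R]_(m, n)) :
  integral_vec u -> (forall i j, B i j \is a Num.int) -> integral_vec (u *m B).
Proof. by move=> hu hB j; rewrite mxE rpred_sum// => i _; rewrite rpredM. Qed.

Lemma finite_integral_box n (N : nat) :
  finite_set [set z : 'rV[R]_n | integral_vec z /\ forall j, `|z 0 j| <= N%:R].
Proof.
pose g (f : {ffun 'I_n -> 'I_(N + N).+1}) : 'rV[R]_n :=
  \row_j ((f j)%:R - N%:R).
apply: (@sub_finite_set _ _ (g @` setT)); last exact/finite_image/finite_finset.
move=> z [zi zN]; exists [ffun j => inord (Num.truncn (z 0 j + N%:R))] => //.
apply/rowP => j; rewrite mxE ffunE.
have := zN j; rewrite ler_norml => /andP[z1 z2].
have zn : z 0 j + N%:R \is a Num.nat.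
  by rewrite natrEint rpredD ?zi ?natr_int//=; lra.
rewrite inordK; last first.
  rewrite ltnS -(ler_nat R) truncnK// natrD; lra.
by rewrite truncnK// addrK.
Qed.

End IntegralVectors.

(** For [x > 0] the remainder is taken in (0, 1] instead of [0, 1), so that subtracting natural
    parts preserves supports. *)
Lemma nat_part_exists (R : realType) (x : R) : 0 <= x -> exists n : nat,
  [/\ 0 <= x - n%:R, x - n%:R <= 1 & (x - n%:R == 0) = (x == 0)].
Proof.
move=> x0; have /andP[] := truncn_itv x0; set t := Num.truncn x => tx xt.
have [xt'|xt'] := eqVneq x t%:R; last first.
  exists t; split; rewrite ?subr_ge0//; first by move: xt; rewrite -natr1; lra.
  rewrite subr_eq0 (negPf xt'); apply/esym/negP => /eqP x0'.
  by rewrite /t x0' truncn0 eqxx in xt'.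
case: t xt' {tx xt} => [|t] ->; first by exists 0%N; rewrite subr0 eqxx lexx ler01.
by exists t; rewrite -natr1 addrAC subrr add0r oner_eq0 ler01 lexx gt_eqF ?ltr_wpDl// ?ler0n.
Qed.

(** * Lattice points of the dilates of one open cell *)

Section CellCount.
Variables (R : realType) (n m : nat) (A : 'M[R]_(m, n)).
Hypothesis A_int : forall i j, A i j \is a Num.int.
Let B := homog A.
Implicit Types (l p : 'rV[R]_m) (z : 'rV[R]_n) (k : nat).

Lemma homog_int i j : B i j \is a Num.int.
Proof. by rewrite mxE; case: fintype.split => a; rewrite ?mxE ?rpred1. Qed.

Lemma total_ker_homog l : l *m B = 0 -> total l = 0.
Proof.
move=> lB; have /eq_homog[_ ->] : l *m B = 0 *m homog A by rewrite lB mul0mx.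
by rewrite /total big1// => i _; rewrite mxE.
Qed.

Lemma integral_homog l : integral_vec (l *m B) <->
  integral_vec (l *m A) /\ total l \is a Num.int.
Proof.
rewrite mul_homog; split=> [h|[h1 h2] j].
  split=> [j|]; first by have := h (lshift 1 j); rewrite row_mxEl.
  by have := h (rshift n 0); rewrite row_mxEr mxE.
by rewrite mxE; case: fintype.split => a; [exact: h1|rewrite mxE].
Qed.

Definition open_cell_points k : set 'rV[R]_n :=
  [set z | integral_vec z /\ exists l : 'rV[R]_m,
     [/\ forall i, 0 < l 0 i, total l = k%:R & z = l *m A]].

(** The remainders left when natural parts are removed from lexicographically maximal weights of
    lattice points; they play the role of the lattice points of half-open parallelepipeds over a
    triangulation. *)
Definition box_points : set 'rV[R]_m := [set p : 'rV[R]_m |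
  [/\ forall i, 0 <= p 0 i <= 1, integral_vec (p *m B), 0 < total p,
      lexmax_supp B (supp p) & interior_supp B (supp p)]].

(** By [lexmax_unique], [p] is determined by [p *m B], an integral vector with bounded
    coordinates. *)
Lemma finite_box_points : finite_set box_points.
Proof.
have inj : {in box_points &, injective (fun p => p *m B)}.
  move=> p p' /set_mem[p0 _ _ pm _] /set_mem[p'0 _ _ p'm _] E.
  by apply: (@lexmax_unique _ _ _ B) => // i; case/andP: (p0 i); case/andP: (p'0 i).
rewrite -(eq_finite_set (inj_card_eq inj)).
pose C : R := \sum_i \sum_j `|B i j|.
have C0 : 0 <= C by apply: sumr_ge0 => i _; exact: sumr_ge0.
apply: (sub_finite_set _ (finite_integral_box R (n + 1) (Num.truncn C).+1)).
move=> _ [p [p01 pB _ _ _] <-]; split=> // j.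
apply: ltW; apply: le_lt_trans (truncnS_gt C).
rewrite mxE; apply: le_trans (ler_norm_sum _ _ _) _; apply: ler_sum => i _.
rewrite (bigD1 j)//= normrM.
have /andP[p0 p1] := p01 i.
rewrite -[leLHS]addr0 lerD ?sumr_ge0// ger0_norm//.
by rewrite -[leRHS]mul1r ler_wpM2r.
Qed.

Let boxes : {fset 'rV[R]_m} := fset_set box_points.

Let box_pointsP (p : boxes) : box_points (val p).
Proof.
by have := valP p; rewrite in_fset_set; [rewrite inE|exact: finite_box_points].
Qed.

Let height (p : 'rV[R]_m) : nat := Num.truncn (total p).

Let heightE p : box_points p -> (height p)%:R = total p.
Proof.
move=> [_ /integral_homog[_ ti] t0 _ _].
by rewrite /height truncnK// natrEint ti ltW.
Qed.

Let height_bounds p : box_points p -> (0 < height p <= #|supp p|)%N.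
Proof.
move=> bp; have [p01 _ t0 _ _] := bp.
rewrite -(ltr0n R) heightE// t0 /= -(ler_nat R) heightE// /total.
rewrite (bigID (mem (supp p)))/= [X in _ + X]big1 ?addr0; last first.
  by move=> i /notin_supp.
rewrite -sum1_card natr_sum ler_sum// => i _.
by case/andP: (p01 i).
Qed.

Let nat_row k (f : {ffun 'I_m -> 'I_k.+1}) : 'rV[R]_m := \row_i (f i)%:R.

Let total_nat_row k (f : {ffun 'I_m -> 'I_k.+1}) :
  total (nat_row f) = (\sum_i f i)%N%:R.
Proof. by rewrite /total natr_sum; apply: eq_bigr => i _; rewrite mxE. Qed.

Let decompositions k : {set boxes * {ffun 'I_m -> 'I_k.+1}} :=
  [set q : boxes * {ffun 'I_m -> 'I_k.+1} |
    [forall i, (i \notin supp (val q.1)) ==> (q.2 i == 0 :> nat)]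
    && (height (val q.1) + \sum_i q.2 i == k)%N]%SET.

Let weights k (q : boxes * {ffun 'I_m -> 'I_k.+1}) : 'rV[R]_m :=
  val q.1 + nat_row q.2.

Let decompositionP k (q : boxes * {ffun 'I_m -> 'I_k.+1}) :
  q \in decompositions k ->
  [/\ forall i, 0 <= weights q 0 i, supp (weights q) = supp (val q.1),
      total (weights q) = k%:R & integral_vec (weights q *m B)].
Proof.
rewrite inE => /andP[/forallP q0 /eqP qk].
have [p01 pB _ _ _] := box_pointsP q.1.
have p0 i : 0 <= val q.1 0 i by case/andP: (p01 i).
split.
- by move=> i; rewrite !mxE addr_ge0.
- apply/finset.setP => i; rewrite !inE !mxE paddr_eq0// pnatr_eq0.
  have /implyP := q0 i; rewrite inE negbK.
  by case: (_ == 0) => //= ->.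
- by rewrite totalD total_nat_row -(heightE (box_pointsP q.1)) -natrD qk.
- rewrite mulmxDl; apply: integral_vecD => //.
  apply: integral_vecM; last exact: homog_int.
  by move=> i; rewrite mxE natr_int.
Qed.

(** The total [k] being fixed, the point determines its lexicographically maximal weights, and these
    determine their natural parts and remainders. *)
Lemma weights_inj k : {in decompositions k &, injective (fun q => weights q *m A)}.
Proof.
move=> q q' hq hq' E.
have [w0 ws wt _] := decompositionP hq; have [w0' ws' wt' _] := decompositionP hq'.
have [p01 _ _ pm _] := box_pointsP q.1; have [p01' _ _ pm' _] := box_pointsP q'.1.
have wE : weights q = weights q'.
  apply: (@lexmax_unique _ _ _ B) => //; rewrite ?ws ?ws'//.
  by apply/eq_homog; rewrite wt wt'.
have sE : supp (val q.1) = supp (val q'.1) by rewrite -ws wE ws'.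
have nE : q.2 = q'.2.
  apply/ffunP => i; apply/val_inj => /=.
  have [iS|iS] := boolP (i \in supp (val q.1)); last first.
    move: hq hq'; rewrite !inE => /andP[/forallP/(_ i)/implyP q0 _].
    move=> /andP[/forallP/(_ i)/implyP q0' _].
    by rewrite (eqP (q0 iS)) (eqP (q0' _))// -sE.
  have /rowP/(_ i) := wE; rewrite !mxE => e.
  have /andP[_ a1] := p01 i; have /andP[_ a1'] := p01' i.
  have a0 : 0 < val q.1 0 i by apply: supp_gt0 => // j; case/andP: (p01 j).
  have a0' : 0 < val q'.1 0 i.
    by apply: supp_gt0; rewrite -?sE// => j; case/andP: (p01' j).
  (* Both remainders lie in (0, 1], so the natural parts differ by less than 1. *)
  by apply/eqP; rewrite eqn_leq; apply/andP; split;
    rewrite -ltnS -(ltr_nat R) -natr1; lra.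
have pE : q.1 = q'.1.
  by apply/val_inj; apply: (addIr (nat_row q.2)); rewrite {2}nE; exact: wE.
by rewrite (surjective_pairing q) pE nE -surjective_pairing.
Qed.

(** Replace positive weights by lexicographically maximal ones and split off natural parts;
    conversely, [interior_suppP] recovers positive weights from the support. *)
Lemma open_cell_pointsE k : (0 < k)%N ->
  open_cell_points k = [set weights q *m A | q in [set` decompositions k]].
Proof.
move=> k0; apply/seteqP; split=> z.
  move=> [zi [l0 [l00 l0k zE]]].
  have l00' i : 0 <= l0 0 i by exact: ltW.
  have [l [lp lB lm]] := lexmax_exists total_ker_homog l00'.
  have [lA lt] : l *m A = l0 *m A /\ total l = total l0 by exact/eq_homog.
  have lint : interior_supp B (supp l) by apply/interior_suppP => //; exists l0.
  have /choice[f fP] := fun i => nat_part_exists (lp i).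
  have lk i : l 0 i <= k%:R.
    by rewrite -l0k -lt /total (bigD1 i)//= lerDl sumr_ge0.
  have fk i : (f i < k.+1)%N.
    by rewrite ltnS -(ler_nat R); have [+ _ _] := fP i; have := lk i; lra.
  pose g : {ffun 'I_m -> 'I_k.+1} := [ffun i => inord (f i)].
  have gE i : g i = f i :> nat by rewrite ffunE inordK.
  pose p := l - nat_row g.
  have pi i : p 0 i = l 0 i - (f i)%:R by rewrite !mxE gE.
  have ps : supp p = supp l.
    by apply/finset.setP => i; rewrite !inE pi; have [_ _ ->] := fP i.
  have lBi : integral_vec (l *m B).
    by apply/integral_homog; rewrite lA -zE lt l0k natr_int.
  have gi : integral_vec (nat_row g) by move=> i; rewrite mxE natr_int.
  have p0 i : 0 <= p 0 i by rewrite pi; have [] := fP i.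
  have bp : box_points p.
    split; rewrite ?ps//.
    - by move=> i; rewrite pi; have [-> -> _] := fP i.
    - rewrite mulmxBl; apply: integral_vecB => //.
      by apply: integral_vecM => //; exact: homog_int.
    (* If [p] were 0, then [l], having the same support, would be 0, against its total [k > 0]. *)
    - rewrite lt_neqAle sumr_ge0// andbT eq_sym; apply/negP.
      rewrite /total psumr_eq0// => /allP pz.
      have : total l = 0.
        rewrite /total big1// => i _; apply: notin_supp; rewrite -ps inE negbK.
        exact: pz (mem_index_enum _).
      by rewrite lt l0k => /eqP; rewrite pnatr_eq0; lia.
  have pb : p \in boxes by rewrite in_fset_set ?inE//; exact: finite_box_points.
  have wE : weights ([` pb]%fset, g) = l by rewrite /weights /= subrK.
  exists ([` pb]%fset, g); last by rewrite wE lA zE.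
  rewrite /= inE /=; apply/andP; split.
    apply/forallP => i; apply/implyP; rewrite ps => /notin_supp li.
    have [+ _ _] := fP i; rewrite li sub0r oppr_ge0 gE => fi.
    by rewrite -(pnatr_eq0 R) eq_le fi ler0n.
  rewrite -(eqr_nat R) natrD heightE// -total_nat_row -totalD.
  by rewrite subrK lt l0k.
move=> [q hq <-].
have [w0 ws wt wi] := decompositionP hq.
have [_ _ _ _ pint] := box_pointsP q.1.
split; first by case/integral_homog: wi.
have /(interior_suppP _ w0)[l l0 /eq_homog[lA lt]] : interior_supp B (supp (weights q)).
  by rewrite ws.
by exists l; rewrite lt lA.
Qed.

Lemma finite_open_cell_points k : (0 < k)%N -> finite_set (open_cell_points k).
Proof. by move=> /open_cell_pointsE ->; exact/finite_image/finite_finset. Qed.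

Lemma fstar_nat_open_cell :
  fstar_nat (fun k => #|` fset_set (open_cell_points k)|%fset).
Proof.
have [a aP] : fstar_nat (fun k => \sum_(p : boxes)
    'C(k.-1 + (#|supp (val p)| - height (val p)), #|supp (val p)|.-1))%N.
  by apply: fstar_nat_sum => p; exact: fstar_nat_bin.
exists a => k; rewrite -aP open_cell_pointsE// card_fset_set_image; last first.
  exact: weights_inj.
rewrite -sum1_card big_mkcond /=.
pose F (p : boxes) (f : {ffun 'I_m -> 'I_k.+2}) : nat :=
  if (p, f) \in decompositions k.+1 then 1 else 0.
rewrite (eq_bigr (fun q => F q.1 q.2)); last by case.
rewrite -(pair_bigA _ F) /F /=.
apply: eq_bigr => p _; rewrite -big_mkcond.
have hb := height_bounds (box_pointsP p).
rewrite -[RHS](card_weak_compositions (ltn0Sn k) hb) -sum1_card.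
by apply: eq_bigl => f; rewrite !inE.
Qed.

End CellCount.

(** * Ehrhart functions of complexes *)

Section Complexes.
Variable R : realType.

Definition cell_lattice n (s : seq 'rV[R]_n) (k : nat) : set 'rV[R]_n :=
  [set z | integral_vec z] `&` [set k%:R *: x | x in relint (polytope s)].

Lemma cell_latticeE n (s : seq 'rV[R]_n) k : (0 < k)%N ->
  cell_lattice s k = open_cell_points (points s) k.
Proof.
move=> k0; apply/seteqP; split=> z [zi zk]; split=> //.
  by apply/(scaled_relintP _ _ k0).
by apply/(scaled_relintP _ _ k0).
Qed.

Lemma points_int n (s : seq 'rV[R]_n) : (forall v, v \in s -> integral_vec v) ->
  forall i j, points s i j \is a Num.int.
Proof. by move=> si i j; rewrite mxE; apply: si; rewrite mem_nth. Qed.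

Lemma ippcell_integral_points n (K : ippcomplex R n) (i : 'I_(ncells K)) :
  exists2 t : seq 'rV[R]_n, polytope t = polytope (cell_points i) &
    forall v, v \in t -> integral_vec v.
Proof.
have [t [tE tv]] := polytope_vertices (cell_points i).
by exists t => // v /tv; exact: cells_integral.
Qed.

(** This guards the counts, because [fset_set] sends an infinite set to the empty one. *)
Lemma finite_cell_lattice n (K : ippcomplex R n) (i : 'I_(ncells K)) k :
  (0 < k)%N -> finite_set (cell_lattice (cell_points i) k).
Proof.
have [t tE /points_int ti] := ippcell_integral_points i => k0.
by rewrite /cell_lattice -tE -/(cell_lattice t k) cell_latticeE//;
  exact: finite_open_cell_points.
Qed.

Lemma fstar_nat_cell n (K : ippcomplex R n) (i : 'I_(ncells K)) :
  fstar_nat (fun k => #|` fset_set (cell_lattice (cell_points i) k)|%fset).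
Proof.
have [t tE /points_int ti] := ippcell_integral_points i.
have [a aP] := fstar_nat_open_cell ti; exists a => k.
by rewrite /cell_lattice -tE -/(cell_lattice t k.+1) cell_latticeE.
Qed.

Lemma ehrhart_sum n (K : ippcomplex R n) k : (0 < k)%N ->
  ehrhart K k =
  (\sum_(i < ncells K) #|` fset_set (cell_lattice (cell_points i) k)|%fset)%N.
Proof.
move=> k0; rewrite -card_fset_set_bigcup.
- rewrite /ehrhart; congr (#|` fset_set _|%fset); apply/seteqP; split=> z.
    by move=> [zi [x [i _ ix] xz]]; exists i => //; split; last by exists x.
  by move=> [i _ [zi [x ix xz]]]; split => //; exists x => //; exists i.
- by move=> i; exact: finite_cell_lattice.
- move=> i j _ _ [z [[_ [x ix xz]] [_ [y jy yz]]]].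
  apply: (@cells_disjoint _ _ K) => //; exists x; split=> //.
  suff -> : x = y by [].
  have k0R : k%:R != 0 :> R by rewrite pnatr_eq0 -lt0n.
  by apply: (scalerI k0R); rewrite xz yz.
Qed.

Lemma fstar_nat_ehrhart n (K : ippcomplex R n) : fstar_nat (ehrhart K).
Proof.
have [a aP] := fstar_nat_sum (@fstar_nat_cell n K).
by exists a => k; rewrite -aP ehrhart_sum.
Qed.

(** The system is unitriangular: evaluation at [i + 1] involves only the coefficients of index at
    most [i], the last one with factor 1. So the two expansions agree by strong induction. *)
Lemma fstar_natP (f : nat -> nat) (p : {poly R}) d (c : 'I_d.+1 -> R) :
  fstar_nat f -> (forall k, p.[k.+1%:R] = (f k.+1)%:R) -> is_fstar p c ->
  forall i, c i \is a Num.nat.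
Proof.
move=> [a aP] pf [_ pc].
suff cE i : (i < d.+1)%N -> c (inord i) = (a i)%:R.
  by move=> i; rewrite -[i]inord_val cE ?natr_nat.
elim/ltn_ind: i => i IH id.
have := pc i.+1%:R; rewrite -natr1 addrK natr1 pf aP.
pose F j := c (inord j) * 'C(i, j)%:R.
rewrite (eq_bigr (fun j : 'I_d.+1 => F j)); last first.
  by move=> j _; rewrite gbinom_nat /F inord_val.
rewrite -(@sum_ord_support _ i.+1 d.+1 F)//; last first.
  by move=> j ij; rewrite /F bin_small// mulr0.
rewrite natr_sum !big_ord_recr /= /F binn !mulr1 muln1.
rewrite (eq_bigr (fun j : 'I_i => F j)) => [/addrI//|j _].
by rewrite natrM /F IH// (ltn_trans (ltn_ord j)).
Qed.

End Complexes.

(** * Translated open standard simplices *)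

Section StandardSimplices.
Variables (R : realType) (d b : nat) (e : 'I_d.+1).

(** Coordinate 0 is reserved for the offset [b]; the simplex itself extends in the coordinates 1 to
    [e]. *)
Definition simplex_vertex (i : nat) : 'rV[R]_d.+1 :=
  b%:R *: delta_mx 0 ord0 + (i != 0%N)%:R *: delta_mx 0 (inord i).

Definition simplex_points : seq 'rV[R]_d.+1 := mkseq simplex_vertex e.+1.

Let s := simplex_points.
Let A := points s.

Let size_s : size s = e.+1. Proof. by rewrite size_mkseq. Qed.

Lemma simplex_pointE (i : 'I_(size s)) j :
  A i j = b%:R * (j == ord0)%:R + (i != 0%N :> nat)%:R * (j == inord i)%:R.
Proof. by rewrite mxE nth_mkseq -?size_s// !mxE eqxx. Qed.

Lemma simplex_points_integral v : v \in s -> integral_vec v.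
Proof.
move=> /mapP[i _ ->] j; rewrite !mxE.
by rewrite rpredD// rpredM// natr_int.
Qed.

Lemma simplex_coord0 (l : 'rV_(size s)) : (l *m A) 0 ord0 = b%:R * total l.
Proof.
rewrite mxE /total mulr_sumr; apply: eq_bigr => i _.
rewrite simplex_pointE eqxx mulr1 mulrC; congr (_ * _).
have [//|i0] := eqVneq (i : nat) 0%N; first by rewrite mul0r addr0.
have ie : (i < d.+1)%N by rewrite (leq_trans (ltn_ord i))// size_s.
by rewrite -val_eqE /= inordK// eq_sym (negPf i0) mulr0 addr0.
Qed.

Lemma simplex_coordS (l : 'rV_(size s)) (i : 'I_(size s)) : i != 0%N :> nat ->
  (l *m A) 0 (inord i) = l 0 i.
Proof.
move=> i0.
have ie (k : 'I_(size s)) : (k < d.+1)%N.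
  by rewrite (leq_trans (ltn_ord k))// size_s.
have i00 : (inord i == ord0 :> 'I_d.+1) = false.
  by rewrite -val_eqE /= inordK// (negPf i0).
rewrite mxE (bigD1 i)//= simplex_pointE i00 i0 eqxx mulr0 add0r !mulr1.
rewrite big1 ?addr0// => k ki; rewrite simplex_pointE i00.
have -> : (inord i == inord k :> 'I_d.+1) = false.
  by rewrite -val_eqE /= !inordK// eq_sym val_eqE (negPf ki).
by rewrite !mulr0 addr0 mulr0.
Qed.

Let i0 : 'I_(size s) := Ordinal (etrans (congr1 (leq 1) size_s) isT).

Lemma simplex_inj (l l' : 'rV_(size s)) : l *m A = l' *m A ->
  total l = total l' -> l = l'.
Proof.
move=> lA; have E i : i != i0 -> l 0 i = l' 0 i.
  by move=> ii; rewrite -!simplex_coordS ?lA.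
rewrite /total (bigD1 i0)//= [RHS](bigD1 i0)//=.
rewrite (eq_bigr (fun i => l' 0 i)) => [/addIr l0|]; last by move=> i /E.
by apply/rowP => i; have [->|/E] := eqVneq i i0.
Qed.

Lemma polytope_simplex_coord0 x : polytope s x -> x 0 ord0 = b%:R.
Proof. by move=> /polytopeP[l [_ l1 ->]]; rewrite simplex_coord0 l1 mulr1. Qed.

(** Relative to the base vertex, all vertices lie in the span of [e] unit vectors. *)
Lemma simplex_dim : (polytope_dim s <= e)%N.
Proof.
pose X : seq 'rV[R]_d.+1 := mkseq (fun i => delta_mx 0 (inord i.+1)) e.
apply: (@leq_trans (\dim <<X>>%VS)); last first.
  by rewrite (leq_trans (dim_span X))// size_mkseq.
apply/dimvS/span_subvP => _ /allpairsP[[x y] /= [xs ys ->]].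
have mem v : v \in s -> v - b%:R *: delta_mx 0 ord0 \in <<X>>%VS.
  move=> /mapP[[|i] ie ->]; rewrite /simplex_vertex /=.
    by rewrite scale0r addr0 subrr mem0v.
  rewrite addrAC subrr add0r scale1r; apply: memv_span.
  apply/mapP; exists i => //; move: ie; rewrite !mem_iota; lia.
pose v : 'rV[R]_d.+1 := b%:R *: delta_mx 0 ord0.
have -> : x - y = (x - v) - (y - v) by rewrite opprB addrA subrK.
by rewrite memvB ?mem.
Qed.

(** Lattice points correspond to positive integral weights of total [k] on [e + 1] vertices;
    lowering each weight by 1 leaves weak compositions of [k - (e + 1)]. *)
Lemma simplex_count k : (0 < k)%N ->
  #|` fset_set (cell_lattice s k)|%fset = 'C(k.-1, e).
Proof.
move=> k0; rewrite cell_latticeE//.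
pose D : {set {ffun 'I_(size s) -> 'I_k.+1}} :=
  [set f : {ffun 'I_(size s) -> 'I_k.+1} |
    [forall i, (i \notin [set: 'I_(size s)]%SET) ==> (f i == 0 :> nat)]
    && (size s + \sum_i f i == k)%N]%SET.
pose w (f : {ffun 'I_(size s) -> 'I_k.+1}) : 'rV[R]_(size s) :=
  \row_i (f i).+1%:R.
have wE f : total (w f) = (size s + \sum_i f i)%N%:R.
  rewrite /total natrD natr_sum -[X in X%:R]card_ord -sum1_card natr_sum.
  by rewrite -big_split; apply: eq_bigr => i _; rewrite mxE -natr1 addrC.
have wt f : f \in D -> total (w f) = k%:R.
  by rewrite inE wE => /andP[_ /eqP ->].
have -> : open_cell_points A k = [set w f *m A | f in [set` D]].
  apply/seteqP; split=> z.
    move=> [zi [l [l0 lk zE]]].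
    (* These weights are coordinates of [z]; the weight of the base vertex is then integral because
       the total is. *)
    have li i : i != i0 -> l 0 i \is a Num.int.
      by move=> ii; rewrite -simplex_coordS// -zE.
    have ln i : l 0 i \is a Num.nat.
      rewrite natrEint (ltW (l0 i)) andbT.
      have [->|/li//] := eqVneq i i0.
      move: lk; rewrite /total (bigD1 i0)//= => /(canRL (addrK _)) ->.
      by rewrite rpredB ?natr_int// rpred_sum.
    have lk' i : l 0 i <= k%:R.
      by rewrite -lk /total (bigD1 i)//= lerDl sumr_ge0// => j _; exact: ltW.
    pose f : {ffun 'I_(size s) -> 'I_k.+1} :=
      [ffun i => inord (Num.truncn (l 0 i)).-1].
    have tl i : (0 < Num.truncn (l 0%R i) <= k)%N.
      by rewrite -(ltr0n R) -(ler_nat R) truncnK// l0 lk'.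
    have wf : w f = l.
      apply/rowP => i; rewrite mxE ffunE inordK; last by have := tl i; lia.
      by rewrite prednK ?truncnK//; case/andP: (tl i).
    exists f; last by rewrite wf zE.
    rewrite /= inE; apply/andP; split.
      by apply/forallP => i; rewrite finset.in_setT.
    by rewrite -(eqr_nat R) -wE wf lk.
  move=> [f fD <-]; split.
    apply: integral_vecM; last exact/points_int/simplex_points_integral.
    by move=> i; rewrite mxE natr_int.
  exists (w f); split=> //; last exact: wt.
  by move=> i; rewrite mxE ltr0n.
rewrite card_fset_set_image.
  rewrite card_weak_compositions//; last by rewrite cardsT card_ord leqnn size_s.
  by rewrite cardsT card_ord subnn addn0 size_s.
move=> f g fD gD /simplex_inj; rewrite !wt// => /(_ erefl)/rowP E.
apply/ffunP => i; apply/val_inj => /=; have := E i; rewrite !mxE => /eqP.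
by rewrite eqr_nat eqSS => /eqP.
Qed.

End StandardSimplices.

Lemma fstar_poly_exists (R : realType) d (c : 'I_d.+1 -> R) :
  exists p : {poly R}, is_fstar p c.
Proof.
(* [gbinom (x - 1) i] has the roots 1 to [i], hence the shift to [j.+1]. *)
exists (\sum_(i < d.+1) (c i / i`!%:R) *: \prod_(j < i) ('X - j.+1%:R%:P)).
split.
  apply: (leq_trans (size_sum _ _ _)); apply/bigmax_leqP => i _.
  apply: (leq_trans (size_scale_leq _ _)).
  by rewrite size_prod_XsubC [index_enum _]unlock -enumT size_enum_ord ltn_ord.
move=> x; rewrite horner_sum; apply: eq_bigr => i _.
rewrite hornerZ horner_prod /gbinom -mulrA [_^-1 * _]mulrC; congr (_ * (_ / _)).
by apply: eq_bigr => j _; rewrite hornerXsubC -natr1; lra.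
Qed.

(** * Realization of vectors of natural numbers *)

Section Realization.
Variables (R : realType) (d : nat) (c : 'I_d.+1 -> nat).

Definition simplex_dims : seq 'I_d.+1 :=
  flatten [seq nseq (c i) i | i <- enum 'I_d.+1].

Let cell (j : 'I_(size simplex_dims)) : seq 'rV[R]_d.+1 :=
  simplex_points R j (nth ord0 simplex_dims j).

Let cell_integral j v : is_vertex (polytope (cell j)) v -> integral_vec v.
Proof. by move=> /vertex_mem; exact: simplex_points_integral. Qed.

Let cell_disjoint :
  trivIset setT (fun j => relint (polytope (cell j))).
Proof.
move=> i j _ _ [x [[xi _] [xj _]]]; apply/val_inj/eqP => /=.
rewrite -(eqr_nat R) -(polytope_simplex_coord0 xi).
by rewrite -(polytope_simplex_coord0 xj).
Qed.

(* The simplices are kept apart by distinct integers in the first coordinate. *)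
Definition simplex_complex : ippcomplex R d.+1 :=
  IPPComplex cell_integral cell_disjoint.

Lemma simplex_complex_dim : (complex_dim simplex_complex <= d)%N.
Proof.
apply/bigmax_leqP => j _; apply: leq_trans (simplex_dim _ _ _) _.
by rewrite -ltnS ltn_ord.
Qed.

Lemma simplex_complex_ehrhart k : (0 < k)%N ->
  ehrhart simplex_complex k = (\sum_(i < d.+1) c i * 'C(k.-1, i))%N.
Proof.
move=> k0; rewrite ehrhart_sum//=.
under eq_bigr do rewrite simplex_count//.
rewrite -(big_mkord xpredT (fun j => 'C(k.-1, nth ord0 simplex_dims j))).
rewrite -(big_nth ord0 xpredT (fun i : 'I_d.+1 => 'C(k.-1, i))).
rewrite /simplex_dims big_flatten big_map big_enum /=.
by apply: eq_bigr => i _; rewrite big_nseq iter_addn_0 mulnC.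
Qed.

End Realization.

Theorem theorem1p2 (R : realType) (d : nat) (c : 'I_d.+1 -> R) :
  (exists (n : nat) (K : ippcomplex R n) (p : {poly R}),
     [/\ (complex_dim K <= d)%N, is_ehrhart_poly K p & is_fstar p c])
  <-> (forall i : 'I_d.+1, c i \is a Num.nat).
Proof.
split=> [[n [K [p [_ Kp]]]]|cn].
  by apply: fstar_natP (fstar_nat_ehrhart K) _ => k; exact: Kp.
have [p pc] := fstar_poly_exists c.
exists d.+1, (simplex_complex R (fun i => Num.truncn (c i))), p.
split=> // [|k k0]; first exact: simplex_complex_dim.
rewrite simplex_complex_ehrhart// pc.2 natr_sum; apply: eq_bigr => i _.
(* Since [k] is at least 1, the predecessor is the real number [k - 1]. *)
by rewrite natrM truncnK// -(gbinom_nat R) -subn1 natrB.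
Qed.
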